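(* Let $q(D)=n^{-1}\sum_{i=1}^n h(W_i)\in\mathbb{R}^m$ be the released workload answer on a dataset $D=(W_1,\dots,W_n)$, and suppose $\|h(W)\|_2\le H_q$ for every record $W$. Measuring $q(D)$ with the Gaussian mechanism under $(\varepsilon,\delta)$-differential privacy yields a noisy answer $\widetilde q$ such that, with probability at least $1-\gamma$, $$\|\widetilde q-q(D)\|_\infty=O\!\left(\frac{H_q\sqrt{\log(m/\gamma)\,\log(1/\delta)}}{n\varepsilon}\right).$$ For the base causal workload, $H_q=\phi_{\max}\sqrt{1+B^2}$. If optional Gram blocks are appended for a direct regression plug-in, one may instead take $H_q=\{\phi_{\max}^2(1+B^2)+\phi_{\max}^4\}^{1/2}$.
   Context: Records are $W=(X,T,Y)$ with $T\in\{0,1\}$, outcome $Y\in[-B,B]$, and a feature map $\phi$ into $\mathbb{R}^p$ with $\|\phi(X)\|_2\le\phi_{\max}$. Two datasets of size $n$ are adjacent, $D\sim D'$, if they differ by replacement of one record, and $\Delta_2=\sup_{D\sim D'}\|q(D)-q(D')\|_2$ is the $\ell_2$ sensitivity. The Gaussian mechanism releases $\widetilde q=q(D)+Z$ with $Z\sim\mathcal N(0,\sigma^2I_m)$ and $\sigma=\Delta_2\sqrt{2\log(1.25/\delta)}/\varepsilon$. The base causal workload has answer $q(D)=[q_0^{(0)}(D),q_1^{(0)}(D),q_0^{(1)}(D),q_1^{(1)}(D)]\in\mathbb{R}^{4p}$ with $q_t^{(0)}(D)=\frac1n\sum_i\mathbf 1\{T_i=t\}\phi(X_i)$ and $q_t^{(1)}(D)=\frac1n\sum_i\mathbf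 1\{T_i=t\}Y_i\phi(X_i)$. The optional Gram blocks are $q_t^{(2)}(D)=\operatorname{vec}\bigl(\frac1n\sum_i\mathbf 1\{T_i=t\}\phi(X_i)\phi(X_i)^\top\bigr)$, $t=0,1$.
   Formalization: The constant in O(·) is uniform only for δ ≤ δ₀, for any fixed δ₀ < 1, and may depend on δ₀; no constant works up to δ = 1, since the noise scale involves log(1.25/δ) while the bound involves log(1/δ), which tends to 0. *)

(* Defs.v *)
From HB Require Import structures.
From mathcomp Require Import all_boot all_order all_algebra.
From mathcomp Require Import all_classical all_reals all_analysis.

Set Implicit Arguments.
Unset Strict Implicit.
Unset Printing Implicit Defensive.

Import Order.TTheory GRing.Theory Num.Theory.
Import numFieldNormedType.Exports.

Local Open Scope classical_set_scope.
Local Open Scope ring_scope.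

Section Definitions.
Context {R : realType}.

(* The library norm `|v| on 'rV[R]_m is the sup norm; this is the l2 norm. *)
Definition l2norm (m : nat) (v : 'rV[R]_m) : R :=
  Num.sqrt (\sum_(j < m) v 0 j ^+ 2).

Record observation (X : Type) (B : R) := Observation {
  covariate : X;
  treatment : bool;
  outcome : R;
  outcome_bounded : - B <= outcome <= B
}.

Definition adjacent (W : Type) (n : nat) (D D' : 'I_n -> W) : Prop :=
  exists i, forall j, j != i -> D j = D' j.

(* [sup] is real-valued: it is the true supremum when the set is bounded, as
   it is for empirical means of bounded functions. *)
Definition sensitivity (W : Type) (n m : nat) (q : ('I_n -> W) -> 'rV[R]_m) : R :=
  sup [set r | exists D D' : 'I_n -> W,
                 adjacent D D' /\ r = l2norm (q D - q D')].

Definition empirical_mean (W : Type) (n m : nat) (h : W -> 'rV[R]_m)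
    (D : 'I_n -> W) : 'rV[R]_m :=
  n%:R^-1 *: \sum_(i < n) h (D i).

(* N(0, s^2). The library's [normal_prob 0 0] is a uniform law, hence the
   explicit point mass for s = 0, which occurs when the query is constant. *)
Definition centered_gaussian (s : R) (A : set R) : \bar R :=
  if s == 0 then \d_(0 : R) A else normal_prob 0 s A.

Section Noise.
Context {d : measure_display} {Omega : measurableType d}.
Variable P : probability Omega R.

(* Since some of the A i may be setT, this is the product rule for every
   subfamily. *)
Definition mutually_independent (m : nat) (Z : 'I_m -> {RV P >-> R}) : Prop :=
  forall A : 'I_m -> set R, (forall j, measurable (A j)) ->
    P (\bigcap_(j in [set: 'I_m]) (Z j @^-1` A j)) =
    (\prod_(j < m) P (Z j @^-1` A j))%E.

(* (Z_0, ..., Z_{m-1}) ~ N(0, s^2 I_m) *)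
Definition isotropic_gaussian (m : nat) (s : R) (Z : 'I_m -> {RV P >-> R}) :
    Prop :=
  (forall j (A : set R), measurable A ->
     P (Z j @^-1` A) = centered_gaussian s A) /\
  mutually_independent Z.

Definition gaussian_scale (W : Type) (n m : nat)
    (q : ('I_n -> W) -> 'rV[R]_m) (eps delta : R) : R :=
  sensitivity q * Num.sqrt (2 * ln ((5 / 4) / delta)) / eps.

Definition gaussian_mechanism (W : Type) (n m : nat)
    (q : ('I_n -> W) -> 'rV[R]_m) (eps delta : R) (D : 'I_n -> W)
    (qtilde : Omega -> 'rV[R]_m) : Prop :=
  exists Z : 'I_m -> {RV P >-> R},
    isotropic_gaussian (gaussian_scale q eps delta) Z /\
    forall w, qtilde w = q D + \row_j Z j w.

End Noise.

(* The high-probability bound with explicit constant C. The range of delta is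
   bounded away from 1 by delta0: the noise scale is proportional to
   sqrt (log (1.25 / delta)), which is not O(sqrt (log (1 / delta))) as delta
   tends to 1. *)
Definition release_error_bound (delta0 C : R) (W : Type) (m : nat)
    (q : forall n, ('I_n -> W) -> 'rV[R]_m) (Hq : R) : Prop :=
  forall (n : nat) (eps delta gamma : R),
    (0 < n)%N -> 0 < eps -> 0 < delta <= delta0 -> 0 < gamma < 1 ->
  forall (d : measure_display) (Omega : measurableType d)
    (P : probability Omega R) (D : 'I_n -> W) (qtilde : Omega -> 'rV[R]_m),
    gaussian_mechanism P (q n) eps delta D qtilde ->
    ((1 - gamma)%:E <=
      P [set w | (`|qtilde w - q n D| <=
          C * (Hq * Num.sqrt (ln (m%:R / gamma) * ln (1 / delta))
               / (n%:R * eps)))%R])%E.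

Section Workloads.
Variables (X : Type) (B : R) (p : nat) (phi : X -> 'rV[R]_p).
Local Notation W := (observation X B).

(* [moment_block t k W] is 1{T = t} Y^k phi(X). *)
Definition moment_block (t : bool) (k : nat) (w : W) : 'rV[R]_p :=
  ((treatment w == t)%:R * outcome w ^+ k) *: phi (covariate w).

(* phi(X) is a row vector, so phi(X) phi(X)^T is phi^T *m phi here. *)
Definition gram_block (t : bool) (w : W) : 'M[R]_p :=
  (treatment w == t)%:R *: ((phi (covariate w))^T *m phi (covariate w)).

Definition base_contribution (w : W) : 'rV[R]_((p + p) + (p + p)) :=
  row_mx (row_mx (moment_block false 0 w) (moment_block true 0 w))
         (row_mx (moment_block false 1 w) (moment_block true 1 w)).

Definition base_answer (n : nat) (D : 'I_n -> W) :
    'rV[R]_((p + p) + (p + p)) :=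
  row_mx (row_mx (empirical_mean (moment_block false 0) D)
                 (empirical_mean (moment_block true 0) D))
         (row_mx (empirical_mean (moment_block false 1) D)
                 (empirical_mean (moment_block true 1) D)).

Definition gram_answer (t : bool) (n : nat) (D : 'I_n -> W) : 'rV[R]_(p * p) :=
  mxvec (n%:R^-1 *: \sum_(i < n) gram_block t (D i)).

Definition full_contribution (w : W) :
    'rV[R]_(((p + p) + (p + p)) + (p * p + p * p)) :=
  row_mx (base_contribution w)
         (row_mx (mxvec (gram_block false w)) (mxvec (gram_block true w))).

Definition full_answer (n : nat) (D : 'I_n -> W) :
    'rV[R]_(((p + p) + (p + p)) + (p * p + p * p)) :=
  row_mx (base_answer D) (row_mx (gram_answer false D) (gram_answer true D)).

End Workloads.

End Definitions.

(* Main.v *)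
Require Import Defs.
From HB Require Import structures.
From mathcomp Require Import all_boot all_order all_algebra.
From mathcomp Require Import all_classical all_reals all_analysis.
From mathcomp Require Import measurable_realfun ring lra.

Set Implicit Arguments.
Unset Strict Implicit.
Unset Printing Implicit Defensive.

Import Order.TTheory GRing.Theory Num.Theory.
Import numFieldNormedType.Exports.

Local Open Scope classical_set_scope.
Local Open Scope ring_scope.

(** The sensitivity of an empirical mean of vectors of norm at most H is at most
    2H/n.  A centered Gaussian of deviation s satisfies
    P(|Z| > t) <= exp (- t^2 / (2 s^2)) without a factor 2, so a union bound over
    the m coordinates puts the sup norm of the noise below
    s sqrt (2 ln (m / gamma)) with probability at least 1 - gamma.  The missing
    factor 2 matters: ln (2 m / gamma) is not O(ln (m / gamma)) when m = 1 and
    gamma tends to 1. *)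

(** * Tail bounds for the centered Gaussian law *)

Section gaussian_tail.
Context {R : realType}.
Local Notation mu := (@lebesgue_measure R).
Implicit Types s t : R.

Let EFin_normal_measurable s (D : set (measurableTypeR R)) :
  measurable D -> measurable_fun D (fun x : R => (normal_pdf 0 s x)%:E).
Proof.
move=> mD; apply/measurable_EFinP; apply: measurable_funTS.
exact: measurable_normal_pdf.
Qed.

Lemma normal_pdfN s x : s != 0 -> normal_pdf 0 s (- x) = normal_pdf 0 s x.
Proof.
by move=> s0; rewrite !normal_pdfE// /normal_fun !subr0 sqrrN.
Qed.

Lemma normal_prob_reflect s t : s != 0 ->
  normal_prob 0 s `]-oo, (- t)%R] = normal_prob 0 s `[t, +oo[.
Proof.
move=> s0; rewrite /normal_prob ge0_integration_by_substitutionNy//.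
- by apply: eq_integral => x _ /=; rewrite normal_pdfN.
- exact/continuous_subspaceT/continuous_normal_pdf.
- by move=> x _; exact: normal_pdf_ge0.
Qed.

(** Reflection exchanges the two closed half lines. The complement of one is open at 0, and adding
    the endpoint back changes no integral. *)
Lemma normal_prob_half s : s != 0 ->
  (normal_prob 0 s `[0%R, +oo[ + normal_prob 0 s `[0%R, +oo[ = 1)%E.
Proof.
move=> s0; rewrite -{2}normal_prob_reflect// oppr0.
rewrite -[RHS](@probability_setT _ _ _ (normal_prob 0 s)).
rewrite -(setUv `]-oo, 0%R]) measureU//; [|exact: measurableC|exact: setICr].
rewrite setCitvl addeC; congr (_ + _)%E.
rewrite /= /normal_prob integral_itv_obnd_cbnd//.
exact: EFin_normal_measurable.
Qed.

(* Since (x + t)^2 >= x^2 + t^2 on x, t >= 0, shifting the tail to the origin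
   gains the Gaussian factor; comparing with the half line rather than with
   the whole line gives the tail bound the constant 1. *)
Lemma normal_prob_upper_tail s t : s != 0 -> 0 <= t ->
  (normal_prob 0 s `[t, +oo[ <=
    (expR (- t ^+ 2 / (s ^+ 2 *+ 2)))%:E * normal_prob 0 s `[0%R, +oo[)%E.
Proof.
move=> s0 t0.
have shiftP (x : R) : is_derive x (1 : R) (shift t : R -> R) 1.
  exact: is_derive_shift.
have dF : ((shift t : R -> R)^`())%classic = cst 1.
  by apply/funext => x; rewrite derive1E; exact: derive_val.
have Ft : t = shift t (0 : R) by rewrite /= add0r.
(* Only the endpoint of the tail is rewritten as the image of 0, so that the substitution x + t
   carries the integral to the half line from 0. *)
rewrite /normal_prob {1}Ft.
rewrite increasing_ge0_integration_by_substitutiony//; first last.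
- by move=> x _; exact: normal_pdf_ge0.
- exact/continuous_subspaceT/continuous_normal_pdf.
- exact: cvg_addrr.
- split=> [x _|]; first exact: ex_derive.
  apply: cvg_at_right_filter; apply/differentiable_continuous/derivable1_diffP.
  exact: ex_derive.
- by rewrite dF; exact: is_cvg_cst.
- by rewrite dF; exact: is_cvg_cst.
- by rewrite dF => ? _; exact: cst_continuous.
- by move=> x y _ _; rewrite ltrD2r.
rewrite dF -ge0_integralZl//=; first last.
- by move=> x _; rewrite lee_fin normal_pdf_ge0.
- exact: EFin_normal_measurable.
apply: ge0_le_integral => //=.
- by move=> x _; rewrite lee_fin mulr1 normal_pdf_ge0.
- apply/measurable_EFinP; apply: measurable_funM => //.
  apply: measurableT_comp; first exact: measurable_normal_pdf.
  exact: measurable_funD.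
- by apply: measurable_funeM; exact: EFin_normal_measurable.
move=> x; rewrite in_itv/= andbT => x0.
rewrite -EFinM lee_fin mulr1 !normal_pdfE// mulrCA.
rewrite ler_wpM2l ?normal_peak_ge0// -expRD ler_expR !subr0 -mulrDl.
by rewrite ler_wpM2r ?invr_ge0 ?mulrn_wge0 ?sqr_ge0//; nra.
Qed.

Lemma measurable_normr_gt t : measurable [set x : R | (t < `|x|)%R].
Proof.
rewrite (_ : mkset _ = (Num.norm : R -> R) @^-1` `]t, +oo[).
  by rewrite -[X in measurable X]setTI; exact: normr_measurable.
by apply/seteqP; split => x /=; rewrite in_itv/= andbT.
Qed.

(** By symmetry both tails obey the same one-sided bound, each with a half-line mass as factor. The
    two masses add up to 1, so no factor 2 appears. *)
Lemma normal_prob_tail s t : s != 0 -> 0 <= t ->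
  (normal_prob 0 s [set x : R | (t < `|x|)%R] <=
    (expR (- t ^+ 2 / (s ^+ 2 *+ 2)))%:E)%E.
Proof.
move=> s0 t0.
have mt : measurable (`]-oo, (- t)%R] `|` `[t, +oo[ : set R).
  by apply: measurableU.
apply: (@le_trans _ _ (normal_prob 0 s (`]-oo, (- t)%R] `|` `[t, +oo[))).
  apply: le_measure; rewrite ?inE//.
  - exact: measurable_normr_gt.
  - move=> x /=; rewrite !in_itv/= andbT.
    by rewrite lter_normr => /orP[|] xt; [right|left]; lra.
apply: (le_trans (measureU2 _ _ _)) => //=.
rewrite normal_prob_reflect//.
have tail := normal_prob_upper_tail s0 t0.
apply: (le_trans (leeD tail tail)).
by rewrite -ge0_muleDr ?measure_ge0// normal_prob_half// mule1.
Qed.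

(** The condition on [t] is written without dividing by [s], so that it also covers [s = 0], where
    the point mass at 0 gives the tail event probability 0. *)
Lemma centered_gaussian_tail s t c : 0 <= t -> 0 <= c ->
  s ^+ 2 * 2 * c <= t ^+ 2 ->
  (centered_gaussian s [set x : R | (t < `|x|)%R] <= (expR (- c))%:E)%E.
Proof.
move=> t0 c0 h; rewrite /centered_gaussian; case: ifPn => [_|s0].
  rewrite diracE memNset ?lee_fin ?expR_ge0//= normr0.
  by apply/negP; rewrite -leNgt.
apply: (le_trans (normal_prob_tail s0 t0)).
rewrite lee_fin ler_expR mulNr lerN2 -(mulr_natr (s ^+ 2)) ler_pdivlMr; last first.
  by rewrite mulr_gt0// exprn_even_gt0.
by rewrite mulrC.
Qed.

End gaussian_tail.

(** * Union bound over the noise coordinates *)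

Section gaussian_noise.
Context {R : realType} {d : measure_display} {Omega : measurableType d}.
Variable P : probability Omega R.

Lemma bigsetU_ordP (T : Type) (m : nat) (F : 'I_m -> set T) (x : T) :
  (\big[setU/set0]_(j < m) F j) x <-> exists j, F j x.
Proof.
split=> [|[j Fjx]]; last by rewrite (bigD1 j)//=; left.
elim/big_ind: _ => // [A B IHA IHB [/IHA|/IHB]//|j _ Fjx].
by exists j.
Qed.

Lemma measure_bigsetU_ord_le (m : nat) (F : 'I_m -> set Omega) :
  (forall j, measurable (F j)) ->
  (P (\big[setU/set0]_(j < m) F j) <= \sum_(j < m) P (F j))%E.
Proof.
move=> mF.
(* Measurability of the partial union is carried through the induction because subadditivity for two
   sets asks for it. *)
suff [] : measurable (\big[setU/set0]_(j < m) F j) /\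
  (P (\big[setU/set0]_(j < m) F j) <= \sum_(j < m) P (F j))%E by [].
elim/big_rec2: _ => [|j r A _ [mA PA]].
  by rewrite measure0; split => //; exact: measurable0.
split; first exact: measurableU.
by apply: (le_trans (measureU2 _ (mF j) mA)); rewrite leeD2l.
Qed.

Lemma isotropic_gaussian_sup_tail (m : nat) (s t gamma : R)
    (Z : 'I_m -> {RV P >-> R}) :
  isotropic_gaussian s Z -> (0 < m)%N -> 0 <= t -> 0 < gamma < 1 ->
  s ^+ 2 * 2 * ln (m%:R / gamma) <= t ^+ 2 ->
  ((1 - gamma)%:E <= P [set w | (`|\row_j Z j w| <= t)%R])%E.
Proof.
move=> [ZP _] m0 t0 /andP[g0 g1] st.
pose A := [set x : R | (t < `|x|)%R].
have mA : measurable A := measurable_normr_gt t.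
have mZA j : measurable (Z j @^-1` A).
  by rewrite -[X in measurable X]setTI; exact: measurable_funPT.
have -> : [set w | `|\row_j Z j w| <= t] =
    ~` \big[setU/set0]_(j < m) (Z j @^-1` A).
  apply/seteqP; split => w /=.
    move=> wt /bigsetU_ordP[j]; rewrite /A/= ltNge => /negP; apply.
    apply: le_trans wt; rewrite [leRHS]/Num.norm/= mx_normrE.
    by apply/bigmax_geP; right; exists (ord0, j) => //=; rewrite mxE.
  (* The maximum defining the sup norm starts from the default 0, so bounding it by [t] also uses
     [0 <= t]. *)
  move=> wA; rewrite [leLHS]/Num.norm/= mx_normrE.
  apply: bigmax_le => // -[i j] _ /=; rewrite mxE leNgt; apply/negP => tZ.
  by apply: wA; apply/bigsetU_ordP; exists j.
rewrite probability_setC; last by apply: bigsetU_measurable.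
rewrite EFinB leeB//; apply: (le_trans (measure_bigsetU_ord_le mZA)).
have m0' : 0 < m%:R :> R by rewrite ltr0n.
(* The failure probability is split evenly: with c = ln (m / gamma) the tail bound exp (- c) is
   exactly gamma / m. *)
apply: (@le_trans _ _ (\sum_(j < m) (gamma / m%:R)%:E)%E).
  apply: lee_sum => j _; rewrite ZP//.
  apply: (le_trans (centered_gaussian_tail t0 _ st)).
    rewrite ln_ge0// ler_pdivlMr// mul1r (le_trans (ltW g1))//.
    by rewrite ler1n.
  by rewrite -lnV ?posrE ?divr_gt0// lnK ?posrE ?invr_gt0 ?divr_gt0// invf_div.
rewrite sumEFin lee_fin big_const_ord iter_addr_0 -[leLHS]mulr_natr divfK//.
by rewrite gt_eqF.
Qed.

End gaussian_noise.

(** * Euclidean norms of differences, blocks and outer products *)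

Section l2norm.
Context {R : realType}.

Lemma l2norm_ge0 m (v : 'rV[R]_m) : 0 <= l2norm v.
Proof. exact: sqrtr_ge0. Qed.

Lemma sqr_l2norm m (v : 'rV[R]_m) : l2norm v ^+ 2 = \sum_j v 0 j ^+ 2.
Proof. by rewrite sqr_sqrtr// sumr_ge0// => j _; rewrite sqr_ge0. Qed.

Lemma sqr_l2norm_row_mx m1 m2 (u : 'rV[R]_m1) (v : 'rV[R]_m2) :
  l2norm (row_mx u v) ^+ 2 = l2norm u ^+ 2 + l2norm v ^+ 2.
Proof.
rewrite !sqr_l2norm big_split_ord/=.
by congr (_ + _); apply: eq_bigr => j _; rewrite (row_mxEl, row_mxEr).
Qed.

Lemma sqr_l2normZ m (a : R) (v : 'rV[R]_m) :
  l2norm (a *: v) ^+ 2 = a ^+ 2 * l2norm v ^+ 2.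
Proof.
by rewrite !sqr_l2norm mulr_sumr; apply: eq_bigr => j _; rewrite mxE exprMn.
Qed.

Lemma l2normZ m (a : R) (v : 'rV[R]_m) : l2norm (a *: v) = `|a| * l2norm v.
Proof.
rewrite -[LHS]ger0_norm ?l2norm_ge0// -sqrtr_sqr sqr_l2normZ.
by rewrite sqrtrM ?sqr_ge0// !sqrtr_sqr (ger0_norm (l2norm_ge0 v)).
Qed.

(** After squaring, it suffices that (a - b)^2 <= 2 a^2 + 2 b^2 in each coordinate, the gap being (a
    + b)^2. This avoids Cauchy-Schwarz. *)
Lemma l2normB_le m (u v : 'rV[R]_m) (H : R) :
  l2norm u <= H -> l2norm v <= H -> l2norm (u - v) <= 2 * H.
Proof.
move=> uH vH; have H0 : 0 <= H := le_trans (l2norm_ge0 u) uH.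
rewrite -ler_sqr ?nnegrE ?l2norm_ge0 ?mulr_ge0//.
have u2 : l2norm u ^+ 2 <= H ^+ 2 by rewrite ler_sqr ?nnegrE ?l2norm_ge0.
have v2 : l2norm v ^+ 2 <= H ^+ 2 by rewrite ler_sqr ?nnegrE ?l2norm_ge0.
apply: (@le_trans _ _ (2 * l2norm u ^+ 2 + 2 * l2norm v ^+ 2)); last by lra.
rewrite !sqr_l2norm !mulr_sumr -big_split/=; apply: ler_sum => j _.
rewrite !mxE -subr_ge0 (_ : _ - _ = (u 0 j + v 0 j) ^+ 2) ?sqr_ge0//.
by ring.
Qed.

Lemma sqr_l2norm_mxvec m n (A : 'M[R]_(m, n)) :
  l2norm (mxvec A) ^+ 2 = \sum_i \sum_j A i j ^+ 2.
Proof.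
rewrite sqr_l2norm (reindex _ (curry_mxvec_bij m n))/= pair_bigA/=.
by apply: eq_bigr => -[i j] _; rewrite /= mxvecE.
Qed.

(** The squared entries of a rank-one matrix are products v_i^2 v_j^2, so their double sum
    factors. *)
Lemma sqr_l2norm_outer m (v : 'rV[R]_m) :
  l2norm (mxvec (v^T *m v)) ^+ 2 = l2norm v ^+ 4.
Proof.
rewrite sqr_l2norm_mxvec (exprM _ 2 2) sqr_l2norm [RHS]expr2 mulr_suml.
apply: eq_bigr => i _; rewrite mulr_sumr; apply: eq_bigr => j _.
by rewrite mxE big_ord1 mxE exprMn.
Qed.

End l2norm.

(** * Sensitivity of empirical means *)

Section empirical_mean.
Context {R : realType} {W : Type}.

Lemma empirical_mean_row_mx n m1 m2 (f : W -> 'rV[R]_m1) (g : W -> 'rV[R]_m2)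
    (D : 'I_n -> W) :
  empirical_mean (fun w => row_mx (f w) (g w)) D =
  row_mx (empirical_mean f D) (empirical_mean g D).
Proof.
rewrite /empirical_mean -scale_row_mx; congr (_ *: _).
by elim/big_rec3: _ => [|i x y z _ ->]; rewrite ?row_mx0 ?add_row_mx.
Qed.

Lemma sensitivity_empirical_mean n m (h : W -> 'rV[R]_m) (H : R)
    (D : 'I_n -> W) :
  (0 < n)%N -> (forall w, l2norm (h w) <= H) ->
  0 <= sensitivity (@empirical_mean R W n m h) <= 2 * H / n%:R.
Proof.
move=> n0 hH; rewrite /sensitivity; set E := [set _ | _].
(* A dataset is adjacent to itself, so 0 lies in [E]. This makes [E] nonempty, as both supremum
   bounds require, and yields the lower bound. *)
have E0 : E 0.
  exists D, D; split; first by exists (Ordinal n0).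
  by rewrite subrr -[X in l2norm X](scale0r 0) l2normZ normr0 mul0r.
have EH : ubound E (2 * H / n%:R).
  move=> _ [D1 [D2 [[i D12] ->]]].
  (* All summands except the replaced record cancel. *)
  have -> : empirical_mean h D1 - empirical_mean h D2 =
      n%:R^-1 *: (h (D1 i) - h (D2 i)).
    rewrite -scalerBr -sumrB (bigD1 i)//= big1 ?addr0// => j ji.
    by rewrite D12// subrr.
  rewrite l2normZ ger0_norm ?invr_ge0// mulrC ler_wpM2r ?invr_ge0//.
  exact: l2normB_le.
apply/andP; split; last by apply: ge_sup => //; exists 0.
by apply: sup_upper_bound => //; split; [exists 0|exists (2 * H / n%:R)].
Qed.

End empirical_mean.

(** * High-probability error of a released empirical mean *)

Section release_error.
Context {R : realType}.
Variable delta0 : R.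
Hypothesis delta0_bounds : 0 < delta0 < 1.

(* Bounds the ratio ln (5 / 4 / delta) / ln (1 / delta) for delta <= delta0. *)
Definition log_ratio : R := 1 + ln (5 / 4) / ln (1 / delta0).

Lemma log_ratio_gt0 : 0 < log_ratio.
Proof.
have /andP[d0 d1] := delta0_bounds.
rewrite ltr_pwDl// divr_ge0// ln_ge0//; first lra.
by rewrite ler_pdivlMr// mul1r ltW.
Qed.

(** The logarithm splits as ln (1 / delta) + ln (5 / 4). Since delta <= delta0, the quotient ln (1 /
    delta) / ln (1 / delta0) is at least 1, which absorbs the constant term. *)
Lemma ln_five_quarters_le delta : 0 < delta <= delta0 ->
  0 <= ln (5 / 4 / delta) <= log_ratio * ln (1 / delta).
Proof.
have /andP[d0 d1] := delta0_bounds.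
move=> /andP[dlt0 dlt]; apply/andP; split.
  by rewrite ln_ge0// ler_pdivlMr//; lra.
have L0 : 0 < ln (1 / delta0) by rewrite ln_gt0// ltr_pdivlMr// mul1r.
rewrite -{1}(div1r delta) lnM ?posrE ?divr_gt0//.
rewrite [leRHS]mulrDl [X in _ <= X + _]mul1r addrC lerD2l mulrAC.
rewrite ler_pdivlMr// ler_wpM2l ?ln_ge0//; first lra.
by rewrite ler_ln ?posrE ?divr_gt0// !div1r lef_pV2 ?posrE.
Qed.

Lemma empirical_mean_release_error (W : Type) m (h : W -> 'rV[R]_m) (H : R) :
  (0 < m)%N -> (forall w, l2norm (h w) <= H) ->
  release_error_bound delta0 (4 * Num.sqrt log_ratio)
    (fun n => @empirical_mean R W n m h) H.
Proof.
move=> m0 hH n eps delta gamma n0 e0 hdelta hgamma d Omega P D qtilde.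
move=> [Z [ZP qE]].
have /andP[S0 SH] := sensitivity_empirical_mean D n0 hH.
have /andP[M0 ML] := ln_five_quarters_le hdelta.
have /andP[g0 g1] := hgamma.
have m0' : 0 < m%:R :> R by rewrite ltr0n.
have n0' : 0 < n%:R :> R by rewrite ltr0n.
have H0 : 0 <= H := le_trans (l2norm_ge0 _) (hH (D (Ordinal n0))).
have K0 := log_ratio_gt0.
have l0 : 0 <= ln (m%:R / gamma).
  by rewrite ln_ge0// ler_pdivlMr// mul1r (le_trans (ltW g1))// ler1n.
have L0 : 0 <= ln (1 / delta) by rewrite -(pmulr_rge0 _ K0) (le_trans M0).
(* The 4 is 2 from the sensitivity bound 2H/n, times sqrt 2 from the noise scale, times sqrt 2 from
   the Gaussian tail. *)
pose t : R := 4 * Num.sqrt log_ratio *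
  (H * Num.sqrt (ln (m%:R / gamma) * ln (1 / delta)) / (n%:R * eps)).
rewrite (_ : [set w | _] = [set w | `|\row_j Z j w| <= t]); last first.
  by apply/funext => w /=; rewrite qE addrAC subrr add0r.
apply: (isotropic_gaussian_sup_tail ZP) => //.
  by rewrite /t !mulr_ge0// ?invr_ge0 ?mulr_ge0// ltW.
rewrite /gaussian_scale /t !exprMn !sqr_sqrtr ?mulr_ge0// ?(ltW K0)//.
set S := sensitivity _ in S0 SH *.
have : S ^+ 2 * ln (5 / 4 / delta) <=
    (2 * H / n%:R) ^+ 2 * (log_ratio * ln (1 / delta)).
  by rewrite ler_pM ?sqr_ge0// ler_sqr ?nnegrE// (le_trans S0).
(* Multiplying by ln (m / gamma) (2 / eps)^2 makes the two sides equal to those of the squared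
   threshold condition. *)
move=> /(ler_wpM2r (mulr_ge0 l0 (sqr_ge0 (2 / eps)))).
congr (_ <= _); field; rewrite ?gt_eqF//.
Qed.

End release_error.

(** * Norm bounds for the causal workloads *)

Section workloads.
Context {R : realType} (X : Type) (B : R) (p : nat) (phi : X -> 'rV[R]_p).

Lemma base_answerE n (D : 'I_n -> observation X B) :
  base_answer phi D = empirical_mean (base_contribution phi) D.
Proof. by rewrite /base_contribution !empirical_mean_row_mx. Qed.

Lemma gram_answerE t n (D : 'I_n -> observation X B) :
  gram_answer phi t D =
  empirical_mean (fun w => mxvec (gram_block phi t w)) D.
Proof. by rewrite /gram_answer linearZ/= linear_sum. Qed.

Lemma full_answerE n (D : 'I_n -> observation X B) :
  full_answer phi D = empirical_mean (full_contribution phi) D.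
Proof.
by rewrite /full_answer !gram_answerE /full_contribution !empirical_mean_row_mx.
Qed.

Lemma sqr_l2norm_moment_block t k (w : observation X B) :
  l2norm (moment_block phi t k w) ^+ 2 =
  (treatment w == t)%:R * (outcome w ^+ k) ^+ 2 * l2norm (phi (covariate w)) ^+ 2.
Proof.
rewrite sqr_l2normZ exprMn; congr (_ * _ * _).
by case: eqP; rewrite ?expr1n ?expr0n.
Qed.

(** Exactly one treatment arm is active, so one block of order 0 and one of order 1 survive,
    contributing the terms 1 and Y^2. *)
Lemma sqr_l2norm_base_contribution (w : observation X B) :
  l2norm (base_contribution phi w) ^+ 2 =
  l2norm (phi (covariate w)) ^+ 2 * (1 + outcome w ^+ 2).
Proof.
rewrite !sqr_l2norm_row_mx !sqr_l2norm_moment_block.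
by case: (treatment w); rewrite /=; ring.
Qed.

Lemma sqr_l2norm_gram_blocks (w : observation X B) :
  l2norm (row_mx (mxvec (gram_block phi false w))
                 (mxvec (gram_block phi true w))) ^+ 2 =
  l2norm (phi (covariate w)) ^+ 4.
Proof.
rewrite sqr_l2norm_row_mx /gram_block !linearZ/= !sqr_l2normZ.
rewrite !sqr_l2norm_outer.
by case: (treatment w); rewrite /=; ring.
Qed.

Variable phimax : R.
Hypothesis phi_le : forall x, l2norm (phi x) <= phimax.

Lemma sqr_l2norm_base_le (w : observation X B) :
  l2norm (base_contribution phi w) ^+ 2 <= phimax ^+ 2 * (1 + B ^+ 2).
Proof.
have F0 : 0 <= l2norm (phi (covariate w)) := l2norm_ge0 _.
have Fle := phi_le (covariate w).
have /andP[Y1 Y2] := outcome_bounded w.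
rewrite sqr_l2norm_base_contribution ler_pM ?sqr_ge0 ?addr_ge0 ?sqr_ge0//.
  by rewrite ler_sqr ?nnegrE// (le_trans F0).
by rewrite lerD2l; nra.
Qed.

Lemma l2norm_base_contribution (w : observation X B) :
  l2norm (base_contribution phi w) <= phimax * Num.sqrt (1 + B ^+ 2).
Proof.
have phimax0 : 0 <= phimax := le_trans (l2norm_ge0 _) (phi_le (covariate w)).
rewrite -ler_sqr ?nnegrE ?l2norm_ge0 ?mulr_ge0 ?sqrtr_ge0//.
have B1 : 0 <= 1 + B ^+ 2 by rewrite addr_ge0 ?sqr_ge0.
by rewrite exprMn (sqr_sqrtr B1) sqr_l2norm_base_le.
Qed.

Lemma l2norm_full_contribution (w : observation X B) :
  l2norm (full_contribution phi w) <=
  Num.sqrt (phimax ^+ 2 * (1 + B ^+ 2) + phimax ^+ 4).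
Proof.
have phimax0 : 0 <= phimax := le_trans (l2norm_ge0 _) (phi_le (covariate w)).
have H0 : 0 <= phimax ^+ 2 * (1 + B ^+ 2) + phimax ^+ 4.
  by rewrite addr_ge0 ?mulr_ge0 ?addr_ge0 ?sqr_ge0 ?exprn_ge0.
rewrite -ler_sqr ?nnegrE ?l2norm_ge0 ?sqrtr_ge0// (sqr_sqrtr H0).
rewrite sqr_l2norm_row_mx sqr_l2norm_gram_blocks lerD ?sqr_l2norm_base_le//.
by rewrite lerXn2r ?nnegrE ?l2norm_ge0.
Qed.

End workloads.

Theorem theorem2 (R : realType) (delta0 : R) (hdelta0 : 0 < delta0 < 1) :
  exists C : R, 0 < C /\
    (forall (X : Type) (B : R) (m : nat) (h : observation X B -> 'rV[R]_m)
        (Hq : R),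
      (0 < m)%N ->
      (forall w, l2norm (h w) <= Hq) ->
      release_error_bound delta0 C (fun n => @empirical_mean R _ n m h) Hq) /\
    (forall (X : Type) (B : R) (p : nat) (phi : X -> 'rV[R]_p) (phimax : R),
      (0 < p)%N ->
      (forall x, l2norm (phi x) <= phimax) ->
      let Hbase := phimax * Num.sqrt (1 + B ^+ 2) in
      let Hgram := Num.sqrt (phimax ^+ 2 * (1 + B ^+ 2) + phimax ^+ 4) in
      [/\ forall n (D : 'I_n -> observation X B),
            base_answer phi D = empirical_mean (base_contribution phi) D,
          forall w : observation X B,
            l2norm (base_contribution phi w) <= Hbase &
          release_error_bound delta0 C (@base_answer R X B p phi) Hbase] /\
      [/\ forall n (D : 'I_n -> observation X B),
            full_answer phi D = empirical_mean (full_contribution phi) D,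
          forall w : observation X B,
            l2norm (full_contribution phi w) <= Hgram &
          release_error_bound delta0 C (@full_answer R X B p phi) Hgram]).
Proof.
(* The constant depends on [delta0] alone, so it is uniform over all queries and both workloads. *)
exists (4 * Num.sqrt (log_ratio delta0)); split.
  by rewrite mulr_gt0// sqrtr_gt0 log_ratio_gt0.
split=> [X B m h Hq m0 hH|X B p phi phimax p0 phi_le Hbase Hgram].
  exact: empirical_mean_release_error.
(* The error bound takes the whole family indexed by [n], so the pointwise identity is lifted to
   families; their type depends on [n], hence dependent extensionality. *)
have baseE : @base_answer R X B p phi =
    (fun n => @empirical_mean R _ n _ (base_contribution phi)).
  by apply: functional_extensionality_dep => n; apply/funext => D;
    exact: base_answerE.
have fullE : @full_answer R X B p phi =
    (fun n => @empirical_mean R _ n _ (full_contribution phi)).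
  by apply: functional_extensionality_dep => n; apply/funext => D;
    exact: full_answerE.
split; split; [exact: base_answerE|exact: l2norm_base_contribution| |
               exact: full_answerE|exact: l2norm_full_contribution| ].
- rewrite baseE; apply: empirical_mean_release_error => //.
    by rewrite !addn_gt0 p0.
  exact: l2norm_base_contribution.
- rewrite fullE; apply: empirical_mean_release_error => //.
    by rewrite !addn_gt0 p0.
  exact: l2norm_full_contribution.
Qed.
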